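(* Let $f:\mathbb{R}^n\to\mathbb{R}$ be continuously differentiable, attain its minimum value $f^*=f(x^* )>-\infty$ at some $x^*$, and satisfy $\frac12\|\nabla f(x)\|_2^2\ge \mu (f(x)-f^* )$ for all $x\in\mathbb{R}^n$, with $\mu>0$. Let $p\in[0,1)$, $q>1$, $\alpha=\frac{p+1}{2}$, $\beta=\frac{q+1}{2}$, $a=(2\mu)^{\alpha}$, $b=(2\mu)^{\beta}$, $x_0\in\mathbb{R}^n$ and $V_0=f(x_0)-f^*$. For a solution $x(t)$ of $\dot x=-g(\nabla f(x))$, $x(0)=x_0$, let $$\mathcal{R}(T,x_0)=\int_0^T(f(x(t))-f^* )\,dt ,$$ and let $T(x_0)$ be its settling time (with $T(x_0)=+\infty$ for $g=g_1$). Then: (i) for $g(y)=g_1(y)=y$: $\mathcal{R}(T(x_0),x_0)\le\dfrac{V_0}{2\mu}$; (ii) for $g(y)=g_p(y)=\dfrac{y}{\|y\|_2^{1-p}}$: $\mathcal{R}(T(x_0),x_0)\le\dfrac{V_0^{2-\alpha}}{a(2-\alpha)}$; (iii) for $g(y)=g_{p,q}(y)=\dfrac{y}{\|y\|_2^{1-p}}+\|y\|_2^{q-1}y$: $$\mathcal{R}(T(x_0),x_0)\le\begin{cases}\dfrac{1}{a(2-\alpha)}+\dfrac{V_0^{2-\beta}}{b(2-\beta)},&\beta\in(1,2),\\[2mm] \dfrac{1}{a(2-\alpha)}+\dfrac{\ln(1+V_0)}{b},&\beta=2,\\[2mm] \dfrac{1}{a(2-\alpha)}+\dfrac{1}{b(\beta-2)},&\beta>2;\end{cases}$$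 (iv) for $g(y)=g_e(y)=\dfrac{y\,e^{\|y\|_2}}{\|y\|_2}$: $\mathcal{R}(T(x_0),x_0)\le\dfrac{1}{\mu^2}$.
   Context: The functions $g$ are set to $0$ at $y=0$. The settling time $T(x_0)$ is the time at which the solution starting from $x_0$ reaches the set of minimizers of $f$ (after which it stays there). Where the right-hand side $X(x)=-g(\nabla f(x))$ is discontinuous, solutions are Filippov solutions: (locally) absolutely continuous $x:[0,\infty)\to\mathbb{R}^n$ with $\dot x(t)\in\mathcal{F}[X](x(t))$ for a.e. $t$, where $\mathcal{F}[X](x)=\bigcap_{\delta>0}\bigcap_{\omega(\mathcal{N}_0)=0}\overline{co}\{X(x^{\delta}\setminus\mathcal{N}_0)\}$, with $x^\delta$ the open ball of radius $\delta$ at $x$, $\omega$ Lebesgue measure, and $\overline{co}$ the closed convex hull. *)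

(* Defs.v *)
From HB Require Import structures.
From mathcomp Require Import all_boot all_order all_algebra.
From mathcomp Require Import all_classical all_reals all_analysis.

Set Implicit Arguments.
Unset Strict Implicit.
Unset Printing Implicit Defensive.

Import Order.TTheory GRing.Theory Num.Theory.
Import numFieldNormedType.Exports.

Local Open Scope classical_set_scope.
Local Open Scope ring_scope.

Section Definitions.
Context {R : realType} {n : nat}.
Implicit Types (X : 'rV[R]_n -> 'rV[R]_n) (x : R -> 'rV[R]_n) (y : 'rV[R]_n).

(* The library's norm `|y| on 'rV[R]_n is the sup norm; it induces the same
   topology as this one. *)
Definition norm2 y : R := Num.sqrt (\sum_i y 0 i ^+ 2).

Definition gradient (f : 'rV[R]_n -> R) y : 'rV[R]_n :=
  \row_i 'D_(delta_mx 0 i) (f : 'rV[R]_n -> R^o) y.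

Definition continuously_differentiable (f : 'rV[R]_n -> R) : Prop :=
  (forall y, differentiable (f : 'rV[R]_n -> R^o) y) /\
  continuous (gradient f).

Definition minimizers (f : 'rV[R]_n -> R) : set 'rV[R]_n :=
  [set y | forall z, f y <= f z].

Definition open_box (a b : 'rV[R]_n) : set 'rV[R]_n :=
  [set y | forall i, a 0 i < y 0 i < b 0 i].

(* The library has no Lebesgue measure on R^n; this is the outer measure, from
   countable covers by boxes. *)
Definition lebesgue_outer_measure (A : set 'rV[R]_n) : \bar R :=
  ereal_inf [set v | exists (D : set nat) (a b : nat -> 'rV[R]_n),
    [/\ forall k i, a k 0 i <= b k 0 i,
        A `<=` \bigcup_(k in D) open_box (a k) (b k) &
        v = (\esum_(k in D) (\prod_i (b k 0 i - a k 0 i))%:E)%E]].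

Definition lebesgue_null (A : set 'rV[R]_n) : Prop :=
  lebesgue_outer_measure A = 0%E.

Definition closed_convex_hull (A : set 'rV[R]_n) : set 'rV[R]_n :=
  smallest [set B : set 'rV[R]_n | closed B /\ convex_set B] A.

Definition ball2 y (r : R) : set 'rV[R]_n := [set z | norm2 (z - y) < r].

Definition filippov X y : set 'rV[R]_n :=
  \bigcap_(d in [set d : R | 0 < d])
    \bigcap_(N in [set N | lebesgue_null N])
      closed_convex_hull (X @` (ball2 y d `\` N)).

(* Trajectories are total functions on R of which only the restriction to
   [0, +oo[ is used: the derivative below is that of the restriction, hence
   one-sided at t = 0. *)
Definition has_derivative_at x (t : R) (v : 'rV[R]_n) : Prop :=
  (fun h : R => h^-1 *: (x (t + h) - x t))
    @ within [set h : R | 0 <= t + h] (0 : R)^' --> v.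

Definition locally_absolutely_continuous x : Prop :=
  forall T : R, 0 < T ->
  forall e : R, 0 < e -> exists2 d : R, 0 < d &
  forall (m : nat) (a b : 'I_m -> R),
    (forall i, [/\ 0 <= a i, a i <= b i & b i <= T]) ->
    trivIset setT (fun i => `]a i, b i[%classic) ->
    \sum_i (b i - a i) < d ->
    \sum_i norm2 (x (b i) - x (a i)) < e.

Definition classical_solution X x : Prop :=
  forall t, 0 <= t -> has_derivative_at x t (X (x t)).

Definition filippov_solution X x : Prop :=
  locally_absolutely_continuous x /\
  {ae @lebesgue_measure R, forall t, 0 <= t ->
    exists2 v, filippov X (x t) v & has_derivative_at x t v}.

Definition solution X (x0 : 'rV[R]_n) x : Prop :=
  [/\ x 0 = x0,
      continuous X -> classical_solution X x &
      ~ continuous X -> filippov_solution X x].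

(* The first time from which on x stays in the set of minimizers of f;
   +oo if there is no such time. *)
Definition settling_time (f : 'rV[R]_n -> R) x : \bar R :=
  ereal_inf [set t%:E | t in [set t : R | 0 <= t /\
    forall s, t <= s -> minimizers f (x s)]].

Definition regret (f : 'rV[R]_n -> R) (fmin : R) x (T : \bar R) : \bar R :=
  (\int[@lebesgue_measure R]_(t in [set t : R | (0 <= t)%R /\ (t%:E <= T)%E])
    (f (x t) - fmin)%:E)%E.

(* All of these take the value 0 at y = 0, being multiples of y. *)
Definition g_1 y : 'rV[R]_n := y.

Definition g_p (p : R) y : 'rV[R]_n := (norm2 y `^ (1 - p))^-1 *: y.

Definition g_pq (p q : R) y : 'rV[R]_n := g_p p y + (norm2 y `^ (q - 1)) *: y.

Definition g_e y : 'rV[R]_n := (expR (norm2 y) / norm2 y) *: y.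

Definition flow_field (f : 'rV[R]_n -> R) (g : 'rV[R]_n -> 'rV[R]_n) y :
  'rV[R]_n := - g (gradient f y).

End Definitions.

(* Main.v *)
Require Import Defs.
From HB Require Import structures.
From mathcomp Require Import all_boot all_order all_algebra.
From mathcomp Require Import all_classical all_reals all_analysis.
From mathcomp Require Import measurable_realfun ring lra.
Import Order.TTheory GRing.Theory Num.Theory.
Import numFieldNormedType.Exports.
Local Open Scope classical_set_scope.
Local Open Scope ring_scope.

(** Along a solution put V(t) = f(x(t)) - f^*.  The regret is the integral of V,
    and V obeys V' <= - phi(V), where phi comes from the gradient inequality
    |grad f|^2 >= 2 mu V: phi(v) = 2 mu v for g_1, a v^alpha for g_p,
    a v^alpha + b v^beta for g_{p,q} and s e^s with s = sqrt(2 mu v) for g_e.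
    Trading time for the value of V,

        int V dt = int V / (-V') dV <= int_0^{V_0} v / phi(v) dv,

    and the four bounds are estimates of the last integral.  To avoid the
    change of variables, let c(v) = v / phi(v), which extends
    continuously to v = 0 in all four cases, let Phi be a primitive of c, and look at
    H(t) = Phi(V(t)) + int_0^t V.  Then H' = c(V) V' + V <= 0, so H decreases and
    int_0^T V <= Phi(V_0) - Phi(0) for every T ([dissipation_integral_le]).
    The bound holds for the integral over the whole half-line, so the settling
    time enters only through monotonicity of the integral ([regret_le]).

    The discontinuous case needs two more remarks.  First, the Filippov
    inclusion determines the velocity where the field is continuous, in
    particular where grad f(x(t)) <> 0 ([filippov_at_continuity]); and where
    grad f(x(t)) = 0 the chain rule gives V'(t) = 0 whatever the velocity is,
    and V'(t) = - <grad f, g(grad f)> is still true ([flow_energy]).  Secondly, the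
    derivative is known only off a null set N, and H has to decrease all the
    same.  For this, absolute continuity is used in the form: the total
    variation of H over intervals covering N can be made arbitrarily small
    ([null_variation]).  A continuous-induction argument then yields
    monotonicity ([null_variation_nonincreasing]).  Classical solutions are the
    case N = set0, where that smallness is void, so both kinds of solution go
    through one proof. *)

Set Implicit Arguments.
Unset Strict Implicit.
Unset Printing Implicit Defensive.

(** * Functions that decrease off a negligible set *)

(** Continuous induction along a segment, in a form adapted to derivatives:
    the step at [w] only has to carry [P] across [w], from a point on its left
    to a point on its right, because a derivative at [w] compares the values of a
    function at [w] with those on both sides but not two values on one side. *)
Lemma segment_creep {R : realType} (P : R -> Prop) (s t : R) : s <= t -> P s ->
  (forall w, s <= w -> w <= t -> exists2 d, 0 < d &
     forall u v, s <= u -> u <= w -> w <= v -> v <= t ->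
       w - d < u -> v < w + d -> P u -> P v) ->
  P t.
Proof.
move=> st Ps step; pose E := [set u | [/\ s <= u, u <= t & P u]].
have Es : E s by split.
have supE : has_sup E by split; [exists s | exists t => u []].
have sw : s <= sup E by apply: ub_le_sup => //; case: supE.
have wt : sup E <= t by apply: ge_sup; [exists s | move=> u []].
have [d d0 Pd] := step _ sw wt.
have [u [su ut Pu] wdu] := sup_adherent d0 supE.
have uw : u <= sup E by apply: ub_le_sup; [case: supE | split].
have wv : sup E <= Num.min (sup E + d / 2) t by rewrite le_min wt andbT; lra.
have vd : Num.min (sup E + d / 2) t < sup E + d by rewrite gt_min; apply/orP; left; lra.
have vt : Num.min (sup E + d / 2) t <= t by rewrite ge_min lexx orbT.
have Pv := Pd u _ su uw wv vt wdu vd Pu.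
have vw : Num.min (sup E + d / 2) t <= sup E.
  by apply: ub_le_sup; [case: supE | split => //; exact: le_trans wv].
move: vw vt Pv; rewrite /Num.min; case: ifPn => //; lra.
Qed.

(** The intervals are listed from left to right, so that a new one is appended at
    the right end, as happens when creeping along a segment. *)
Definition packing {R : realType} (A : set R) (m : nat) (a b : nat -> R) : Prop :=
  (forall i, (i < m)%N -> a i <= b i /\ `[a i, b i]%classic `<=` A) /\
  (forall i j, (i < j)%N -> (j < m)%N -> b i <= a j).

(** [d u v] is a size attached to the interval [u, v], such as |F v - F u| or
    the length v - u.  The definition says that the variation of [d] on [N], in
    the sense of Henstock's variational measure, vanishes.  It keeps from
    absolute continuity exactly what the monotonicity theorem uses, and for
    [N = set0] it is void. *)
Definition null_variation {R : realType} (d : R -> R -> R) (N : set R) : Prop :=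
  forall T e : R, 0 < T -> 0 < e -> exists U : set R,
    [/\ open U, N `<=` U & forall m a b, packing (U `&` `[0, T]) m a b ->
      \sum_(i < m) d (a i) (b i) <= e].

Lemma null_variation_set0 {R : realType} (d : R -> R -> R) :
  null_variation d set0.
Proof.
move=> T e T0 e0; exists set0; split; [exact: open0 | exact: sub0set |].
move=> [|m] a b [ab _]; first by rewrite big_ord0 ltW.
have [ab0 /(_ (a 0%N))] := ab 0%N (ltn0Sn m).
by rewrite /= !in_itv/= lexx ab0 => /(_ isT)[].
Qed.

Lemma null_variation_le {R : realType} (d d' : R -> R -> R) (N : set R) :
  (forall T : R, 0 < T -> exists2 K, 0 < K &
     forall u v, 0 <= u -> u <= v -> v <= T -> d u v <= K * d' u v) ->
  null_variation d' N -> null_variation d N.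
Proof.
move=> dd' nv T e T0 e0; have [K K0 dK] := dd' T T0.
have [U [oU NU sumU]] := nv T (e / K) T0 (divr_gt0 e0 K0).
exists U; split => // m a b pab.
have := sumU m a b pab; rewrite ler_pdivlMr// mulrC mulr_sumr; apply: le_trans.
apply: ler_sum => i _; have [ab abU] := pab.1 i (ltn_ord i).
have := abU (a i); rewrite /= !in_itv/= lexx ab => /(_ isT)[_ /andP[a0 _]].
have := abU (b i); rewrite /= !in_itv/= lexx ab => /(_ isT)[_ /andP[_ bT]].
exact: dK.
Qed.

Lemma packing_extend {R : realType} (A : set R) m (a b : nat -> R) (u v : R) :
  packing A m a b -> (forall i, (i < m)%N -> b i <= u) -> u <= v ->
  `[u, v]%classic `<=` A ->
  packing A m.+1 (fun i => if (i < m)%N then a i else u)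
                 (fun i => if (i < m)%N then b i else v).
Proof.
move=> [ab chain] bu uv uvA; split=> [i _|i j ij jm].
  by case: ifPn => // im; exact: ab.
have im : (i < m)%N by exact: leq_trans ij _.
by rewrite im; case: ifPn => jm'; [exact: chain | exact: bu].
Qed.

(** Writing F z - F w = g z (z - w) with [g] continuous at [w] and g w = D <= 0,
    both F v - F w and F w - F u inherit the bound g <= e near [w]. *)
Lemma derive_le0_straddle {R : realType} (F : R -> R) (w D e : R) : D <= 0 ->
  is_derive w 1 F D -> 0 < e -> exists2 d, 0 < d &
  forall u v, u <= w -> w <= v -> w - d < u -> v < w + d ->
    F v - F u <= e * (v - u).
Proof.
move=> D0 /is_derive1_caratheodory[g [Fg cg gw]] e0.
have : g w < D + e by rewrite gw ltrDl.
have /cvgrPdist_lt/(_ e e0)/nbhs_ballP[d /= d0 gd] := cg.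
have ge z : w - d < z -> z < w + d -> g z <= e.
  move=> z1 z2; have : ball w d z by rewrite /ball/= ltr_distlC; lra.
  by move=> /gd /=; rewrite gw ltr_distlC => /andP[_]; lra.
move=> _; exists d => // u v uw wv du dv.
have gv : g v * (v - w) <= e * (v - w).
  by rewrite ler_wpM2r ?subr_ge0// ge//; lra.
have gu : g u * (w - u) <= e * (w - u).
  by rewrite ler_wpM2r ?subr_ge0// ge//; lra.
by have := Fg u; have := Fg v; lra.
Qed.


(** Creep from [s] to [t], maintaining
    F u - F s <= k (u - s) + (variation over a packing inside U and left of u),
    where the open set [U] contains [N] and packings in [U] have variation at
    most [k].  Crossing a point outside [N] uses the derivative and enlarges the
    first term; crossing a point of [N] adds one interval to the packing.  At
    the end F t - F s <= k (t - s + 1), and [k] is arbitrary. *)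
Lemma null_variation_nonincreasing {R : realType} (F : R -> R) (N : set R) :
  null_variation (fun u v => `|F v - F u|) N ->
  forall s t, 0 <= s -> s <= t ->
  (forall w, s <= w -> w <= t -> ~ N w ->
     exists2 D, D <= 0 & is_derive w 1 F D) ->
  F t <= F s.
Proof.
move=> nv s t s0; rewrite le_eqVlt => /predU1P[->//|st dF].
have t0 : 0 < t by exact: le_lt_trans st.
apply/ler_addgt0Pr => e e0; set k := e / (t - s + 1).
have k0 : 0 < k by rewrite divr_gt0//; lra.
have [U [oU NU sumU]] := nv t k t0 k0.
have [m [a [b [pab _ Fst]]]] : exists m a b,
    [/\ packing (U `&` `[0, t]) m a b, forall i, (i < m)%N -> b i <= t &
        F t - F s <= k * (t - s) + \sum_(i < m) `|F (b i) - F (a i)|].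
  apply: (segment_creep (P := fun u => exists m a b,
    [/\ packing (U `&` `[0, t]) m a b, forall i, (i < m)%N -> b i <= u &
        F u - F s <= k * (u - s) + \sum_(i < m) `|F (b i) - F (a i)|])
    (ltW st)).
    exists 0%N, (fun=> 0), (fun=> 0); split => //.
    by rewrite big_ord0 !subrr mulr0 addr0.
  move=> w sw wt; have [Nw|Nw] := pselect (N w).
    have /nbhs_ballP[d /= d0 wU] := open_nbhs_nbhs (conj oU (NU _ Nw)).
    exists d => // u v su uw wv vt du dv [m [a [b [pab bu Fu]]]].
    exists m.+1, (fun i => if (i < m)%N then a i else u),
                 (fun i => if (i < m)%N then b i else v); split.
    - apply: packing_extend pab bu (le_trans uw wv) _ => z /=.
      rewrite !in_itv/= => /andP[uz zv]; split.
        by apply: wU; rewrite /ball/= ltr_distlC; lra.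
      by lra.
    - move=> i _; case: ifPn => // im.
      exact: le_trans (bu _ im) (le_trans uw wv).
    - rewrite big_ord_recr/= ltnn.
      under eq_bigr do rewrite ltn_ord.
      have := ler_norm (F v - F u).
      have : k * (u - s) <= k * (v - s) by apply: ler_wpM2l; [exact: ltW | lra].
      by lra.
  have [D D0 dFw] := dF w sw wt Nw.
  have [d d0 Fd] := derive_le0_straddle D0 dFw k0.
  exists d => // u v su uw wv vt du dv [m [a [b [pab bu Fu]]]].
  exists m, a, b; split => //.
    by move=> i im; exact: le_trans (bu _ im) (le_trans uw wv).
  have := Fd u v uw wv du dv.
  have -> : k * (v - s) = k * (v - u) + k * (u - s) by ring.
  lra.
have := sumU m a b pab.
have : k * (t - s + 1) = e by rewrite divfK//; lra.
lra.
Qed.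

Lemma packing_disjoint {R : realType} (A : set R) m (a b : nat -> R) i j :
  packing A m a b -> (i < m)%N -> (j < m)%N -> i != j ->
  `]a i, b i[ `&` `]a j, b j[ = set0 :> set R.
Proof.
move=> [_ chain]; wlog ij : i j / (i < j)%N.
  move=> W im jm ij; have [ij'|ji] := ltnP i j; first exact: W.
  by rewrite setIC; apply: W; rewrite // 1?eq_sym// ltn_neqAle eq_sym ij.
move=> im jm _; apply/seteqP; split => // z [] /=; rewrite !in_itv/=.
by have := chain i j ij jm; lra.
Qed.

Lemma packing_length {R : realType} (U : set R) m (a b : nat -> R) :
  open U -> packing U m a b ->
  ((\sum_(i < m) (b i - a i))%:E <= @lebesgue_measure R U)%E.
Proof.
move=> oU pab; have [ab chain] := pab.
pose F i := if (i < m)%N then `]a i, b i[%classic else set0 : set R.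
have mF i : measurable (F i) by rewrite /F; case: ifPn.
have tF : trivIset setT F.
  apply/trivIsetP => i j _ _ ij; rewrite /F.
  case: ifPn; rewrite ?set0I// => im; case: ifPn; rewrite ?setI0// => jm.
  exact: packing_disjoint pab im jm ij.
apply: (@le_trans _ _ (lebesgue_measure (\big[setU/set0]_(i < m) F i))).
  rewrite measure_bigsetU// -sumEFin lee_sum// => i _.
  have [abi _] := ab i (ltn_ord i).
  apply: (@le_trans _ _ (@lebesgue_measure R `]a i, b i[%classic)); last first.
    by rewrite /F ltn_ord.
  rewrite lebesgue_measure_itv/= lte_fin.
  by case: ltP => ? //; rewrite lee_fin; lra.
apply: le_measure; rewrite ?inE//.
- by apply: bigsetU_measurable => i _; exact: mF.
- exact: open_measurable.
- rewrite -bigcup_mkord => z [i /= im]; rewrite /F im => zi.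
  have [_] := ab i im; apply.
  exact: (subset_itv_oo_cc zi).
Qed.

Lemma null_sub_open {R : realType} (N : set R) (e : R) : 0 < e ->
  (@lebesgue_measure R).-negligible N ->
  exists U, [/\ open U, N `<=` U & (@lebesgue_measure R U < e%:E)%E].
Proof.
move=> e0 [A [mA A0 NA]].
have [|//|U [oU AU UA]] := @lebesgue_regularity_outer R A e mA.
  by rewrite [X in (X < _)%E]A0.
exists U; split => //; first exact: subset_trans AU.
suff <- : @lebesgue_measure R (U `\` A) = @lebesgue_measure R U by [].
have mU := open_measurable oU.
rewrite [RHS](_ : _ = lebesgue_measure (U `\` A `|` A)); last first.
  by rewrite setDKU.
rewrite measureU//; last 2 first.
- exact: measurableD.
- by rewrite setDE -setIA setICl setI0.
by rewrite [X in (_ + X)%E]A0 adde0.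
Qed.

(** Cover [N] by an open set of measure less than the modulus of absolute
    continuity: packings inside it have small total length, hence small total
    variation.  The length v - u is kept in the sum because the integral of the
    energy, which is Lipschitz in time, is compared with it. *)
Lemma abs_continuous_null_variation {R : realType} {n : nat}
    (x : R -> 'rV[R]_n) (N : set R) :
  locally_absolutely_continuous x ->
  (@lebesgue_measure R).-negligible N ->
  null_variation (fun u v => norm2 (x v - x u) + (v - u)) N.
Proof.
move=> ac N0 T e T0 e0.
have e20 : 0 < e / 2 by lra.
have [d d0 xd] := ac T T0 (e / 2) e20.
have [|U [oU NU Ud]] := @null_sub_open R N (Num.min d (e / 2)) _ N0.
  by rewrite lt_min d0.
exists U; split => // m a b pab.
have pU : packing U m a b.
  split; [move=> i im|exact: pab.2].
  by have [ab abU] := pab.1 i im; split => // z /abU [].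
have := le_lt_trans (packing_length oU pU) Ud.
rewrite lte_fin lt_min => /andP[sd se].
rewrite big_split/=.
suff : \sum_(i < m) norm2 (x (b i) - x (a i)) < e / 2 by lra.
apply: (xd m (fun i => a i) (fun i => b i)) => //; last first.
  apply/trivIsetP => i j _ _ ij.
  exact: packing_disjoint pab (ltn_ord i) (ltn_ord j) ij.
move=> i; have [ab abU] := pab.1 i (ltn_ord i).
have := abU (a i); have := abU (b i); rewrite /= !in_itv/= !lexx ab.
by move=> /(_ isT)[_ /andP[_ ->]] /(_ isT)[_ /andP[-> _]].
Qed.

(** Only the half-line above [m] is asked for; with [m] negative this gives
    two-sided derivatives at 0. *)
Lemma continuous_primitive {R : realType} (h : R -> R) (m : R) :
  continuous h -> exists F : R -> R, forall t, m < t -> is_derive t 1 F (h t).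
Proof.
move=> ch; exists (fun t => \int[lebesgue_measure]_(z in `[m, t]) h z)%R => t mt.
have t1 : t < t + 1 by lra.
have [|D1 D2] := @continuous_FTC1_closed R h m t (t + 1) t1 _ mt (ch t).
  apply: continuous_compact_integrable; first exact: segment_compact.
  exact: continuous_subspaceT.
by rewrite -D2 derive1E; exact: derivableP.
Qed.

Lemma primitive_nondecreasing {R : realType} (F h : R -> R) (u v : R) : u <= v ->
  (forall t, u <= t -> t <= v -> is_derive t 1 F (h t)) ->
  (forall t, u <= t -> t <= v -> 0 <= h t) -> F u <= F v.
Proof.
move=> uv dF h0.
have [||c] := @MVT_segment R F h u v uv.
- by move=> t; rewrite in_itv/= => /andP[/ltW ut /ltW tv]; exact: dF.
- apply: derivable_within_continuous => t; rewrite in_itv/= => /andP[ut tv].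
  exact: (@ex_derive _ _ _ _ _ _ _ (dF t ut tv)).
rewrite in_itv/= => /andP[uc cv] Fuv.
by rewrite -subr_ge0 Fuv mulr_ge0// ?h0// subr_ge0.
Qed.

Lemma derive_lipschitz {R : realType} (F h : R -> R) (a b : R) : a <= b ->
  continuous h -> (forall t, a <= t -> t <= b -> is_derive t 1 F (h t)) ->
  exists2 K, 0 <= K & forall u v, a <= u -> u <= b -> a <= v -> v <= b ->
    `|F v - F u| <= K * `|v - u|.
Proof.
move=> ab ch dF.
have cnh : continuous (fun t => `|h t|).
  by move=> t; apply: (continuous_comp (ch t)); exact: norm_continuous.
have [w _ hw] := EVT_max ab (continuous_subspaceT cnh).
exists `|h w| => // u v.
wlog uv : u v / u <= v.
  move=> W au ub av vb; have [uv|vu] := leP u v; first exact: W.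
  by rewrite distrC [X in _ * X]distrC; apply: W => //; exact: ltW.
move=> au ub av vb.
have [||z] := @MVT_segment R F h u v uv.
- move=> t; rewrite in_itv/= => /andP[/ltW ut /ltW tv]; apply: dF.
    exact: le_trans ut.
  exact: le_trans vb.
- apply: derivable_within_continuous => t; rewrite in_itv/= => /andP[ut tv].
  exact: (@ex_derive _ _ _ _ _ _ _ (dF t (le_trans au ut) (le_trans tv vb))).
rewrite in_itv/= => /andP[uz zv] ->.
rewrite normrM ler_wpM2r//; apply: hw; rewrite in_itv/=; apply/andP; split.
  exact: le_trans uz.
exact: le_trans vb.
Qed.

Lemma integral_halfline_le {R : realType} (V W : R -> R) (B : R) :
  continuous V -> (forall t, 0 <= V t) ->
  (forall t : R, 0 <= t -> is_derive t 1 W (V t)) ->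
  (forall t : R, 0 <= t -> W t - W 0 <= B) ->
  (\int[@lebesgue_measure R]_(t in `[0%R, +oo[) (V t)%:E <= B%:E)%E.
Proof.
move=> cV V0 dW WB.
have mV : measurable_fun setT (EFin \o V).
  by apply/measurable_EFinP; exact: continuous_measurable_fun.
have -> : `[0%R, +oo[%classic = \bigcup_n `[0%R, n%:R : R]%classic.
  apply/seteqP; split => [t|t [n _]] /=; rewrite !in_itv/= andbT => t0;
    last by case/andP: t0.
  by exists (Num.bound t) => //=; rewrite in_itv/= t0/= ltW// archi_boundP.
have cvI : (\int[@lebesgue_measure R]_(t in [set` `[0%R, (n%:R : R)]]) (V t)%:E)%E
    @[n --> \oo] -->
    (\int[@lebesgue_measure R]_(t in \bigcup_n `[0%R, (n%:R : R)]%classic) (V t)%:E)%E.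
  apply: ge0_nondecreasing_set_cvg_integral.
  - apply/nondecreasing_seqP => n; apply/subsetPset => t /=.
    rewrite !in_itv/= => /andP[-> tn]; apply: le_trans tn _.
    by rewrite ler_nat.
  - by move=> n; exact: measurable_itv.
  - by move=> n; exact: measurable_funTS.
  - by move=> n t _; rewrite lee_fin.
rewrite -(cvg_lim _ cvI)//; apply: lime_le; first by apply/cvg_ex; eexists; exact: cvI.
near=> n.
have n0 : (0 : R) < n%:R by rewrite ltr0n; near: n; exact: nbhs_infty_gt.
have cW (t : R) : 0 <= t -> {for t, continuous W}.
  by move=> t0; apply/differentiable_continuous/derivable1_diffP; have [] := dW t t0.
rewrite (@continuous_FTC2 _ V W)//.
- by rewrite -EFinB lee_fin WB// ltW.
- exact: continuous_subspaceT.
- split.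
  + by move=> t; rewrite in_itv/= => /andP[/ltW/dW[]].
  + by apply: cvg_at_right_filter; apply: cW.
  + by apply: cvg_at_left_filter; apply: cW; exact: ltW.
- move=> t; rewrite in_itv/= => /andP[/ltW/dW dWt _].
  by rewrite derive1E derive_val.
Unshelve. all: by end_near. Qed.

Lemma max0_id {R : realType} (t : R) : 0 <= t -> Num.max 0 t = t.
Proof. by move=> t0; exact/max_r. Qed.

(** H(t) = Phi(V(t)) + int_0^t V satisfies H' = c(V) V' + V <= 0 off [N], because
    c(V) V' <= - c(V) phi(V) <= - V.  Its increments are bounded by those of [V]
    and of time, as [Phi] and the integral are Lipschitz on bounded sets, so its
    variation on [N] vanishes too and [H] is nonincreasing on ]0, T]; continuity
    extends this to 0. *)
Lemma dissipation_integral_le {R : realType} (V phi c Phi : R -> R) (N : set R) :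
  (forall t, 0 <= t -> 0 <= V t) ->
  continuous (fun t : R => V (Num.max 0 t)) ->
  null_variation (fun u v => `|V v - V u| + (v - u)) N ->
  (forall t : R, 0 < t -> ~ N t ->
     exists2 D, D <= - phi (V t) & is_derive t 1 V D) ->
  continuous c -> (forall v, 0 <= v -> 0 <= c v) ->
  (forall v, 0 <= v -> v <= c v * phi v) ->
  (forall v : R, 0 <= v -> is_derive v 1 Phi (c v)) ->
  (\int[@lebesgue_measure R]_(t in `[0%R, +oo[) (V t)%:E
     <= (Phi (V 0) - Phi 0)%:E)%E.
Proof.
move=> V0 cV nv dV cc c0 cphi dPhi.
pose Vp t := V (Num.max 0 t).
have VpE t : 0 <= t -> Vp t = V t by move=> t0; rewrite /Vp max0_id.
have Vp0 t : 0 <= Vp t by rewrite V0// le_max lexx.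
have [W dW'] := continuous_primitive (-1) cV.
have dW (t : R) : 0 <= t -> is_derive t 1 W (Vp t) by move=> t0; apply: dW'; lra.
rewrite (_ : (\int[_]_(t in _) _)%E =
    (\int[@lebesgue_measure R]_(t in `[0%R, +oo[) (Vp t)%:E)%E); last first.
  by apply: eq_integral => t; rewrite inE/= in_itv/= andbT => t0; rewrite VpE.
apply: (integral_halfline_le cV Vp0 dW) => T; rewrite le_eqVlt => /predU1P[<-|T0].
  rewrite subrr subr_ge0; apply: (@primitive_nondecreasing _ Phi c) => //.
  - exact: V0.
  - by move=> t t0 _; exact: dPhi.
  - by move=> t t0 _; exact: c0.
pose H t := Phi (V t) + W t.
suff HT : H T <= H 0.
  have : Phi 0 <= Phi (V T).
    apply: (@primitive_nondecreasing _ Phi c) => //.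
    - exact/V0/ltW.
    - by move=> t t0 _; exact: dPhi.
    - by move=> t t0 _; exact: c0.
  by move: HT; rewrite /H; lra.
have Hnv : null_variation (fun u v => `|H v - H u|) N.
  apply: null_variation_le nv => S S0.
  have [m _ Vm] := EVT_max (ltW S0) (continuous_subspaceT cV).
  have Vpm : 0 <= Vp m by [].
  have [K K0 PhiK] := derive_lipschitz Vpm cc (fun v v0 _ => dPhi v v0).
  have [L L0 WL] := derive_lipschitz (ltW S0) cV (fun t t0 _ => dW t t0).
  exists (K + L + 1); first by lra.
  move=> u v u0 uv vS.
  have v0 : 0 <= v by exact: le_trans uv.
  have uS : u <= S by exact: le_trans vS.
  have Vb t : 0 <= t -> t <= S -> V t <= Vp m.
    by move=> t0 tS; rewrite -VpE//; apply: Vm; rewrite in_itv/= t0.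
  have h1 := PhiK (V u) (V v) (V0 u u0) (Vb u u0 uS) (V0 v v0) (Vb v v0 vS).
  have h2 := WL u v u0 uS v0 vS.
  have uv0 : 0 <= v - u by rewrite subr_ge0.
  rewrite (ger0_norm uv0) in h2.
  have -> : H v - H u = (Phi (V v) - Phi (V u)) + (W v - W u).
    by rewrite /H; ring.
  apply: le_trans (ler_normD _ _) _.
  have := normr_ge0 (V v - V u).
  set A := `|V v - V u| in h1 *; move=> A0.
  have : 0 <= K * (v - u) by exact: mulr_ge0.
  have : 0 <= L * A by exact: mulr_ge0.
  lra.
have Hle s : 0 < s -> s <= T -> H T <= H s.
  move=> s0 sT; apply: (null_variation_nonincreasing Hnv (ltW s0) sT) => w sw wT Nw.
  have w0 : 0 < w by exact: lt_le_trans sw.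
  have [D Dphi dVw] := dV w w0 Nw.
  exists (c (V w) * D + V w); last first.
    apply: is_deriveD; last by rewrite -VpE ?ltW//; exact/dW/ltW.
    by apply: is_derive1_comp; exact/dPhi/V0/ltW.
  have Vw := V0 w (ltW w0).
  have := ler_wpM2l (c0 _ Vw) Dphi; have := cphi _ Vw; lra.
have cHp : continuous_at 0 (fun t => Phi (Vp t) + W t).
  apply: continuousD.
    apply: continuous_comp; first exact: cV.
    by apply/differentiable_continuous/derivable1_diffP; have [] := dPhi (Vp 0) (Vp0 0).
  by apply/differentiable_continuous/derivable1_diffP; have [] := dW 0 (lexx 0).
rewrite leNgt; apply/negP => HT.
have e0 : 0 < H T - H 0 by lra.
have /cvgrPdist_lt/(_ _ e0)/nbhs_ballP[d /= d0 Hd] := cHp.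
pose s := Num.min (d / 2) T.
have s0 : 0 < s by rewrite lt_min T0 andbT; lra.
have sT : s <= T by rewrite ge_min lexx orbT.
have sd : s <= d / 2 by rewrite ge_min lexx.
have /Hd /= : ball 0 d s by rewrite /ball/= sub0r normrN gtr0_norm//; lra.
have s00 := ltW s0; rewrite !VpE// ltr_distlC -/(H 0) -/(H s).
by have := Hle s s0 sT; lra.
Qed.

(** * Calculus along a curve in R^n *)

Definition dot {R : realType} {n : nat} (u v : 'rV[R]_n) : R :=
  \sum_i u 0 i * v 0 i.

Section Euclidean.
Context {R : realType} {n : nat}.
Implicit Types (u v y z : 'rV[R]_n).

Lemma norm2_ge0 y : 0 <= norm2 y.
Proof. exact: sqrtr_ge0. Qed.

Lemma norm2_sqr y : norm2 y ^+ 2 = dot y y.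
Proof.
rewrite sqr_sqrtr; first by apply: eq_bigr => i _; rewrite expr2.
by apply: sumr_ge0 => i _; exact: sqr_ge0.
Qed.

Lemma coord_le_norm2 y i : `|y 0 i| <= norm2 y.
Proof.
rewrite -sqrtr_sqr ler_sqrt; last by apply: sumr_ge0 => j _; exact: sqr_ge0.
by rewrite (bigD1 i)//= lerDl; apply: sumr_ge0 => j _; exact: sqr_ge0.
Qed.

Lemma norm2_eq0 y : norm2 y = 0 -> y = 0.
Proof.
move=> y0; apply/rowP => i; rewrite mxE; apply/eqP; rewrite -normr_le0 -y0.
exact: coord_le_norm2.
Qed.

Lemma norm2_0 : norm2 (0 : 'rV[R]_n) = 0.
Proof. by rewrite /norm2 big1 ?sqrtr0// => i _; rewrite mxE expr0n. Qed.

Lemma norm2N y : norm2 (- y) = norm2 y.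
Proof. by congr Num.sqrt; apply: eq_bigr => i _; rewrite mxE sqrrN. Qed.

Lemma norm2_gt0 y : y != 0 -> 0 < norm2 y.
Proof.
move=> y0; rewrite lt_neqAle norm2_ge0 eq_sym andbT.
by apply: contra_neq y0 => /norm2_eq0.
Qed.

Lemma sup_norm_le_norm2 y : `|y| <= norm2 y.
Proof.
rewrite /Num.norm/= mx_normrE; apply/bigmax_leP; split; first exact: norm2_ge0.
by move=> [i j] _ /=; rewrite (ord1 i) coord_le_norm2.
Qed.

Lemma norm2_continuous : continuous (@norm2 R n).
Proof.
move=> y; apply: continuous_comp; last exact: sqrt_continuous.
apply: continuous_big => [|i _ {}y]; first exact: add_continuous.
exact: (continuous_comp (@coord_continuous R 1 n 0 i y) (@exprn_continuous R 2 _)).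
Qed.

Lemma dot0v v : dot 0 v = 0.
Proof. by rewrite /dot big1// => i _; rewrite mxE mul0r. Qed.

Lemma dotvZ u v a : dot u (a *: v) = a * dot u v.
Proof. by rewrite mulr_sumr; apply: eq_bigr => i _; rewrite mxE mulrCA. Qed.

Lemma dotvN u v : dot u (- v) = - dot u v.
Proof. by rewrite -scaleN1r dotvZ mulN1r. Qed.

Lemma dotvD u v z : dot u (v + z) = dot u v + dot u z.
Proof. by rewrite -big_split; apply: eq_bigr => i _; rewrite mxE mulrDr. Qed.

Lemma dot_le u v : `|dot u v| <= (\sum_i `|u 0 i|) * norm2 v.
Proof.
apply: le_trans (ler_norm_sum _ _ _) _; rewrite mulr_suml.
by apply: ler_sum => i _; rewrite normrM ler_wpM2l// coord_le_norm2.
Qed.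

Lemma diff_gradient (f : 'rV[R]_n -> R) y v :
  differentiable (f : 'rV[R]_n -> R^o) y ->
  'd (f : 'rV[R]_n -> R^o) y v = dot (gradient f y) v.
Proof.
move=> df; rewrite {1}[v]row_sum_delta linear_sum.
apply: eq_bigr => i _; rewrite linearZ/= mxE deriveE//.
exact: mulrC.
Qed.


Lemma is_derive_along (f : 'rV[R]_n -> R) (x : R -> 'rV[R]_n) (t : R) v :
  differentiable (f : 'rV[R]_n -> R^o) (x t) -> is_derive t 1 x v ->
  is_derive t 1 (f \o x) (dot (gradient f (x t)) v).
Proof.
move=> df dx.
have dx' : differentiable x t by apply/derivable1_diffP; have [] := dx.
have dfx : differentiable ((f : 'rV[R]_n -> R^o) \o x) t by exact: differentiable_comp.
apply: DeriveDef; first by apply/derivable1_diffP.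
rewrite deriveE// diff_comp//= -diff_gradient//; congr ('d _ _ _).
by rewrite -deriveE// derive_val.
Qed.

Lemma is_derive_segment y w (t : R) : is_derive t 1 (fun r : R => y + r *: w) w.
Proof.
have dd : is_diff t (cst y + (fun r : R => r *: w)) (0 + (fun r : R => r *: w)).
  exact: is_diffD.
apply: DeriveDef; first by apply/derivable1_diffP.
by rewrite deriveE// diff_val/= add0r scale1r.
Qed.

(** The gradient is bounded on the ball, which is compact and convex; integrate
    along segments. *)
Lemma C1_lipschitz_on_balls (f : 'rV[R]_n -> R) (r : R) :
  continuously_differentiable f -> exists2 K, 0 < K &
  forall y z, `|y| <= r -> `|z| <= r -> `|f z - f y| <= K * norm2 (z - y).
Proof.
move=> [df cf]; pose G y := \sum_i `|gradient f y 0 i|.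
have cG : continuous G.
  apply: continuous_big => [|i _ y]; first exact: add_continuous.
  have cfi := continuous_comp (cf y) (@coord_continuous R 1 n 0 i (gradient f y)).
  exact: (continuous_comp cfi (@norm_continuous R R^o _)).
pose B := [set y : 'rV[R]_n | `|y| <= r].
have cB : compact B.
  apply: bounded_closed_compact.
    by exists r; split; [exact: num_real | move=> M rM y /= /le_trans; apply; exact: ltW].
  apply: (@closed_comp _ _ (fun y : 'rV[R]_n => `|y|) [set a | a <= r]).
    by move=> y _; exact: norm_continuous.
  exact: closed_le.
have [M [_ GM]] := compact_bounded (continuous_compact (continuous_subspaceT cG) cB).
pose K := Num.max (M + 1) 1.
have GK y : B y -> G y <= K.
  move=> By; have MK : M < K by rewrite lt_max ltrDl ltr01.
  exact: le_trans (ler_norm _) (GM K MK (G y) (imageP _ By)).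
exists K; first by rewrite lt_max ltr01 orbT.
move=> y z yr zr.
pose F (t : R) := f (y + t *: (z - y)).
have dF (t : R) : is_derive t 1 F (dot (gradient f (y + t *: (z - y))) (z - y)).
  apply: is_derive_along; [exact: df | exact: is_derive_segment].
have [|t] := @MVT_segment R F _ 0 1 ler01 (fun t _ => dF t).
  by apply: derivable_within_continuous => t _; have [] := dF t.
rewrite in_itv/= => /andP[t0 t1].
rewrite /F scale1r scale0r addr0 subrKC subr0 mulr1 => ->.
apply: le_trans (dot_le _ _) _; rewrite ler_wpM2r ?norm2_ge0//; apply: GK.
rewrite /B/= (_ : _ + _ = (1 - t) *: y + t *: z); last first.
  by rewrite scalerBr scalerBl scale1r addrCA addrC.
apply: le_trans (ler_normD _ _) _; rewrite !normrZ (ger0_norm t0) ger0_norm ?subr_ge0//.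
have : (1 - t) * `|y| <= (1 - t) * r by rewrite ler_wpM2l// subr_ge0.
have : t * `|z| <= t * r by rewrite ler_wpM2l.
lra.
Qed.

(** Small balls are mapped by [X] into a closed ball around [X y], which is closed
    and convex and so contains the hull; the exceptional null set can be taken
    empty. *)
Lemma filippov_at_continuity (X : 'rV[R]_n -> 'rV[R]_n) y v :
  continuous_at y X -> filippov X y v -> v = X y.
Proof.
move=> cX Xv; apply/eqP; rewrite eq_sym -subr_eq0 -normr_le0.
apply/ler_addgt0Pr => e e0; rewrite add0r.
have /cvgrPdist_le/(_ e e0)/nbhs_ballP[d /= d0 Xd] := cX.
have null0 : lebesgue_null (set0 : set 'rV[R]_n).
  apply/eqP; rewrite eq_le; apply/andP; split.
    apply: ereal_inf_lbound; exists set0, (fun=> 0), (fun=> 0); split => //.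
    by rewrite esum_set0.
  apply: le_ereal_inf_tmp => _ [D [a [b [ab _ ->]]]].
  apply: esum_ge0 => k _; rewrite lee_fin prodr_ge0// => i _.
  by rewrite subr_ge0.
apply: (Xv d d0 set0 null0 (closed_ball_ (fun u => `|u|) (X y) e)); split; last first.
  move=> _ [z [yz _] <-]; apply: Xd; rewrite -ball_normE/=.
  by rewrite distrC; apply: le_lt_trans yz; exact: sup_norm_le_norm2.
split; first exact: closed_closed_ball_.
move=> u w l; rewrite !inE /closed_ball_/= => uX wX.
have l1 : 0 <= 1 - l%:num by rewrite subr_ge0.
rewrite [X in `|X|](_ : _ = l%:num *: (X y - u) + (1 - l%:num) *: (X y - w)); last first.
  by rewrite !scalerBr addrACA -opprD -scalerDl subrKC scale1r.
apply: le_trans (ler_normD _ _) _; rewrite !normrZ (ger0_norm l1) ger0_norm//.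
have l0 : 0 <= l%:num by [].
have := ler_wpM2l l0 uX; have := ler_wpM2l l1 wX; lra.
Qed.

Lemma has_derivative_at_interior (x : R -> 'rV[R]_n) (t : R) v :
  0 < t -> has_derivative_at x t v -> is_derive t 1 x v.
Proof.
move=> t0 dx.
have cv : (fun h : R => h^-1 *: (x (h *: 1 + t) - x t)) @ 0^' --> v.
  move=> A vA; have near_t : \forall h \near (0 : R)^', 0 <= t + h.
    apply/nbhs_ballP; exists t => // h; rewrite /ball/= sub0r normrN => ht _.
    by have := ler_norm (- h); rewrite normrN; lra.
  move: (dx A vA); rewrite /nbhs/= /within/=; apply: filterS2 near_t => h th.
  by move=> /(_ th); rewrite /preimage/= [h *: 1]mulr1 [h + t]addrC.
apply: DeriveDef; first by apply/cvg_ex; exists v.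
exact: cvg_lim cv.
Qed.

End Euclidean.

(** * The energy along a solution *)

Section Trajectories.
Context {R : realType} {n : nat}.
Implicit Types (x : R -> 'rV[R]_n) (X g : 'rV[R]_n -> 'rV[R]_n)
  (f : 'rV[R]_n -> R).

Lemma max0_dist (s t : R) : `|Num.max 0 t - Num.max 0 s| <= `|t - s|.
Proof.
have := ler_norm (t - s); have := ler_norm (s - t); rewrite distrC ler_norml.
by rewrite /Num.max; case: ifPn; case: ifPn; rewrite -?leNgt; lra.
Qed.

(** Composing with [Num.max 0] turns continuity on the closed half-line into
    continuity on the line, which is the form that integration and the extreme
    value theorem use. *)
Lemma continuous_halfline x :
  (forall t : R, 0 <= t -> forall e, 0 < e -> exists2 d, 0 < d &
     forall s, 0 <= s -> `|s - t| < d -> `|x s - x t| < e) ->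
  continuous (fun t : R => x (Num.max 0 t)).
Proof.
move=> cx t; apply/cvgrPdist_lt => e e0.
have [|d d0 xd] := cx (Num.max 0 t) _ e e0; first by rewrite le_max lexx.
apply/nbhs_ballP; exists d => // s; rewrite /ball/= => ts.
rewrite distrC; apply: xd; first by rewrite le_max lexx.
by rewrite distrC; apply: le_lt_trans ts; exact: max0_dist.
Qed.

Lemma abs_continuous_continuous x : locally_absolutely_continuous x ->
  continuous (fun t : R => x (Num.max 0 t)).
Proof.
move=> ac; apply: continuous_halfline => t t0 e e0.
have t1 : 0 < t + 1 by lra.
have [d d0 xd] := ac (t + 1) t1 e e0.
exists (Num.min d 1) => [|s s0]; first by rewrite lt_min d0 ltr01.
rewrite lt_min => /andP[sd s1]; have st1 : s <= t + 1.
  by have := ler_norm (s - t); lra.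
apply: le_lt_trans (sup_norm_le_norm2 _) _.
have one a b : 0 <= a -> a <= b -> b <= t + 1 -> b - a < d ->
    norm2 (x b - x a) < e.
  move=> a0 ab bt bad; have := xd 1%N (fun=> a) (fun=> b).
  rewrite !big_ord1; apply => //.
  by apply/trivIsetP => i j _ _; rewrite !ord1.
have [ts|st] := leP t s.
  by apply: one => //; apply: le_lt_trans sd; exact: ler_norm.
rewrite -opprB norm2N; apply: one => //; [exact: ltW | lra |].
by apply: le_lt_trans sd; rewrite distrC; exact: ler_norm.
Qed.

Lemma has_derivative_continuous x :
  (forall t, 0 <= t -> exists v, has_derivative_at x t v) ->
  continuous (fun t : R => x (Num.max 0 t)).
Proof.
move=> dx; apply: continuous_halfline => t t0 e e0.
have [v /cvgrPdist_lt/(_ 1 ltr01)] := dx t t0.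
rewrite near_withinE => /nbhs_ballP[d /= d0 xd].
(* |x s - x t| <= (|v| + 1) |s - t| for s near t. *)
pose k := `|v| + 1.
have k0 : 0 < k by rewrite ltr_wpDl.
exists (Num.min d (e / k)) => [|s s0]; first by rewrite lt_min d0 divr_gt0.
rewrite lt_min => /andP[sd se].
have [->|st] := eqVneq s t; first by rewrite subrr normr0.
have st0 : s - t != 0 by rewrite subr_eq0.
have : ball 0 d (s - t) by rewrite /ball/= sub0r normrN.
move=> /xd/(_ st0); rewrite /= subrKC => /(_ s0) vx.
have : `|(s - t)^-1 *: (x s - x t)| < k.
  rewrite -[X in `|X|](subKr v); apply: le_lt_trans (ler_normB _ _) _.
  by rewrite ltrD2l.
rewrite normrZ normfV mulrC ltr_pdivrMr ?normr_gt0// => /lt_trans; apply.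
by rewrite mulrC -ltr_pdivlMr.
Qed.

(** The chain rule gives V' = <grad f(x), v> with [v] the velocity.  If
    grad f(x) = 0 both sides vanish and [v] need not be known.  Otherwise the
    field is continuous at [x t] and [v] is its value there. *)
Lemma flow_energy f g x (x0 : 'rV[R]_n) (fmin : R) :
  continuously_differentiable f ->
  (forall y : 'rV[R]_n, y != 0 -> continuous_at y g) ->
  solution (flow_field f g) x0 x ->
  let V t := f (x t) - fmin in
  [/\ continuous (fun t : R => V (Num.max 0 t)) &
   exists2 N : set R,
     null_variation (fun u v => `|V v - V u| + (v - u)) N &
     forall t : R, 0 < t -> ~ N t ->
       is_derive t 1 V (- dot (gradient f (x t)) (g (gradient f (x t))))].
Proof.
move=> fC1 cg [_ classical filip] V; have [df cf] := fC1.
have dV t v : 0 < t -> has_derivative_at x t v ->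
    is_derive t 1 V (dot (gradient f (x t)) v).
  move=> t0 /(has_derivative_at_interior t0)/(is_derive_along (df (x t))) dfx.
  have := is_deriveB dfx (is_derive_cst fmin t 1).
  by rewrite subr0.
have cV : continuous (fun t : R => x (Num.max 0 t)) ->
    continuous (fun t : R => V (Num.max 0 t)).
  move=> cx t; apply: continuousB; last exact: cvg_cst.
  exact: (continuous_comp (cx t) (differentiable_continuous (df _))).
have [cX|ncX] := pselect (continuous (flow_field f g)).
  have dx := classical cX; split.
    by apply/cV/has_derivative_continuous => t t0; eexists; exact: dx.
  exists set0; first exact: null_variation_set0.
  by move=> t t0 _; rewrite -dotvN; apply: dV t0 (dx t (ltW t0)).
have [ac ae] := filip ncX.
have cx := abs_continuous_continuous ac.
split; first exact: cV.
exists (~` [set t | 0 <= t -> exists2 v, filippov (flow_field f g) (x t) v &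
    has_derivative_at x t v]).
  apply: null_variation_le (abs_continuous_null_variation ac ae) => T T0.
  have cnx : continuous (fun t : R => `|x (Num.max 0 t)|).
    by move=> t; apply: (continuous_comp (cx t)); exact: norm_continuous.
  have [m _ xm] := EVT_max (ltW T0) (continuous_subspaceT cnx).
  have [K K0 fK] := C1_lipschitz_on_balls `|x (Num.max 0 m)| fC1.
  exists (K + 1) => [|u v u0 uv vT]; first by lra.
  have xb t : 0 <= t -> t <= T -> `|x t| <= `|x (Num.max 0 m)|.
    by move=> t0 tT; have := xm t; rewrite in_itv/= t0 tT max0_id//; apply.
  have -> : V v - V u = f (x v) - f (x u) by rewrite /V; ring.
  have := fK (x u) (x v) (xb u u0 (le_trans uv vT)) (xb v (le_trans u0 uv) vT).
  have := norm2_ge0 (x v - x u).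
  have : 0 <= K * (v - u) by rewrite mulr_ge0 ?subr_ge0// ltW.
  lra.
move=> t t0 /contrapT/(_ (ltW t0))[v Fv dxv].
have [g0|g0] := eqVneq (gradient f (x t)) 0.
  by have := dV t v t0 dxv; rewrite g0 !dot0v oppr0.
suff vX : v = flow_field f g (x t) by rewrite -dotvN; apply: dV t0 _; rewrite vX in dxv.
apply: filippov_at_continuity Fv.
apply: continuousN; apply: continuous_comp; [exact: cf | exact: cg].
Qed.

(** The primitives of [c] are quantified in the hypothesis since each application
    bounds their increment by comparison with an explicit function, without
    computing them. *)
Lemma regret_le f g x (x0 : 'rV[R]_n) (fmin B : R) (T : \bar R)
    (phi c : R -> R) :
  continuously_differentiable f -> (forall y, fmin <= f y) ->
  (forall y : 'rV[R]_n, y != 0 -> continuous_at y g) ->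
  (forall y, phi (f y - fmin) <= dot (gradient f y) (g (gradient f y))) ->
  continuous c -> (forall v, 0 <= v -> 0 <= c v) ->
  (forall v, 0 <= v -> v <= c v * phi v) ->
  (forall Phi : R -> R, (forall v : R, 0 <= v -> is_derive v 1 Phi (c v)) ->
     Phi (f x0 - fmin) - Phi 0 <= B) ->
  solution (flow_field f g) x0 x ->
  (regret f fmin x T <= B%:E)%E.
Proof.
move=> fC1 fm cg phig cc c0 cphi PhiB sol.
have [Phi dPhi'] := continuous_primitive (-1) cc.
have dPhi (v : R) : 0 <= v -> is_derive v 1 Phi (c v) by move=> v0; apply: dPhi'; lra.
apply: le_trans (_ : (Phi (f x0 - fmin) - Phi 0)%:E <= _)%E; last by rewrite lee_fin PhiB.
have [cV [N nv dV]] := flow_energy fmin fC1 cg sol.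
have x00 : x 0 = x0 by case: sol.
have V0 t : 0 <= f (x t) - fmin by rewrite subr_ge0.
rewrite -x00; apply: le_trans (dissipation_integral_le _ cV nv _ cc c0 cphi dPhi).
- rewrite /regret.
  pose F t := (f (x (Num.max 0 t)) - fmin)%:E.
  have mF (D : set R) : measurable D -> measurable_fun D F.
    move=> mD; apply: measurable_funTS; apply/measurable_EFinP.
    exact: continuous_measurable_fun.
  have mT : measurable [set t : R | (0 <= t)%R /\ (t%:E <= T)%E].
    case: T => [r| |].
    - rewrite (_ : [set _ | _] = `[0%R, r]%classic); first exact: measurable_itv.
      by apply/seteqP; split => t /=; rewrite in_itv/= lee_fin; [case=> -> | case/andP].
    - rewrite (_ : [set _ | _] = `[0%R, +oo[%classic); first exact: measurable_itv.
      apply/seteqP; split => t /=; rewrite in_itv/= andbT; first by case.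
      by move=> t0; rewrite leey.
    - rewrite (_ : [set _ | _] = set0); first exact: measurable0.
      by apply/seteqP; split => // t [].
  have eF (D : set R) : D `<=` [set t | 0 <= t] ->
      (\int[@lebesgue_measure R]_(t in D) (f (x t) - fmin)%:E)%E =
      (\int[@lebesgue_measure R]_(t in D) F t)%E.
    by move=> D0; apply: eq_integral => t /set_mem /D0 /= t0; rewrite /F max0_id.
  rewrite !eF; [|by move=> t /=; rewrite in_itv/= andbT|by move=> t []].
  apply: ge0_subset_integral => //.
  - exact: mF.
  - by move=> t _; rewrite lee_fin subr_ge0.
  - by move=> t [t0 _]; rewrite /= in_itv/= t0.
- by [].
- move=> t t0 Nt; exists (- dot (gradient f (x t)) (g (gradient f (x t)))).
    by rewrite lerN2.
  exact: dV.
Qed.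
End Trajectories.

(** * Powers, and the right-hand sides of the flows *)

Section PowerFunctions.
Context {R : realType}.
Implicit Types (k u v r t : R).

Lemma continuous_at_powR r v : 0 < v -> continuous_at v (fun t => t `^ r).
Proof.
move=> v0; apply/differentiable_continuous/derivable1_diffP.
by have [] := is_derive1_powR r v0.
Qed.

(** The absolute value makes the power continuous on the whole line, [powR] being 1 at
    negative bases. *)
Lemma continuous_norm_powR r : 0 < r -> continuous (fun v : R => `|v| `^ r).
Proof.
move=> r0 v; have [->|v0] := eqVneq v 0; last first.
  have v1 : 0 < `|v| by rewrite normr_gt0.
  exact: (continuous_comp (@norm_continuous R R^o v) (continuous_at_powR (r := r) v1)).
apply/cvgrPdist_lt => e e0; have er0 : 0 < e `^ r^-1 by exact: powR_gt0.
apply/nbhs_ballP; exists (e `^ r^-1) => // t; rewrite /ball/= sub0r normrN => te.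
rewrite normr0 powR0 ?gt_eqF// sub0r normrN ger0_norm ?powR_ge0//.
have -> : e = (e `^ r^-1) `^ r by rewrite -powRrM mulVf ?gt_eqF// powRr1// ltW.
by rewrite gt0_ltr_powR// nnegrE// ltW.
Qed.

Lemma within_continuous_powR r k v : 0 < r ->
  {within `[0, v], continuous (fun t : R => t `^ r * k)}.
Proof.
move=> r0; apply: (@subspace_eq_continuous _ _ _ (fun t : R => `|t| `^ r * k)).
  by move=> t; rewrite inE/= in_itv/= => /andP[t0 _]; rewrite ger0_norm.
apply: continuous_subspaceT => t.
by apply: cvgMr_tmp; exact: continuous_norm_powR.
Qed.

(** Replaces monotonicity of the integral: [F] is a primitive of [h], and [G] is
    explicit and grows at least as fast. *)
Lemma primitive_increment_le (F G h : R -> R) u v : u <= v ->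
  (forall t, u <= t -> t <= v -> is_derive t 1 F (h t)) ->
  (forall t, u < t -> t < v -> exists2 k, is_derive t 1 G k & h t <= k) ->
  {within `[u, v], continuous G} ->
  F v - F u <= G v - G u.
Proof.
move=> uv dF dG cG.
have cF : {within `[u, v], continuous F}.
  apply: derivable_within_continuous => t; rewrite in_itv/= => /andP[ut tv].
  by have [] := dF t ut tv.
rewrite -subr_ge0 (_ : _ - _ = (G - F) v - (G - F) u); last first.
  by rewrite !fctE; ring.
move: uv; rewrite le_eqVlt => /predU1P[uv|uv]; first by rewrite uv subrr.
have [||t] := @MVT R (G - F) (fun t => 'D_1 G t - h t) u v uv.
- move=> t; rewrite in_itv/= => /andP[ut tv]; have [k dGt _] := dG t ut tv.
  apply: is_deriveB; last by apply: dF; exact: ltW.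
  by have [? _] := dGt; exact: derivableP.
- move=> t; apply: continuousD _; first exact: cG.
  by apply: continuousN _; exact: cF.
rewrite in_itv/= => /andP[ut tv] ->; have [k dGt hk] := dG t ut tv.
by rewrite derive_val mulr_ge0// subr_ge0// ltW.
Qed.

Lemma is_derive_powR_primitive (k r t : R) : 0 < t -> r != 0 ->
  is_derive t 1 (fun v : R => v `^ r / (k * r)) (k^-1 * t `^ (r - 1)).
Proof.
move=> t0 r0.
have -> : (fun v : R => v `^ r / (k * r)) =
    (k * r)^-1 *: ((fun v : R => v `^ r) : R -> R^o).
  by apply/funext => v; rewrite mulrC.
apply: (is_derive_eq (is_deriveZ _ (is_derive1_powR r t0))).
by rewrite /GRing.scale/= invfM mulrA -[X in X * _]mulrA mulVf// mulr1.
Qed.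

(** Raises the gradient inequality to the power r / 2. *)
Lemma powR_sqr_le (m v r N : R) : 0 <= m -> 0 <= v -> 0 <= N -> 0 <= r ->
  m * v <= N ^+ 2 -> m `^ (r / 2) * v `^ (r / 2) <= N `^ r.
Proof.
move=> m0 v0 N0 r0 mvN; rewrite -powRM//.
have -> : N `^ r = (N ^+ 2) `^ (r / 2).
  by rewrite -powR_mulrn// -powRrM mulrC divfK.
by apply: ge0_ler_powR; rewrite ?nnegrE ?divr_ge0 ?mulr_ge0 ?sqr_ge0.
Qed.

End PowerFunctions.

Section Fields.
Context {R : realType} {n : nat}.
Implicit Types y : 'rV[R]_n.

Lemma continuous_norm2_powR r y : 0 < norm2 y ->
  continuous_at y (fun z : 'rV[R]_n => norm2 z `^ r).
Proof.
by move=> y0; exact: (continuous_comp (@norm2_continuous R n y)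
  (continuous_at_powR (r := r) y0)).
Qed.

Lemma continuous_g_p (p : R) y : y != 0 -> continuous_at y (g_p p).
Proof.
move=> /norm2_gt0 y0; rewrite -[g_p p]/(fun z => (norm2 z `^ (1 - p))^-1 *: z).
have N0 : norm2 y `^ (1 - p) != 0 by rewrite gt_eqF// powR_gt0.
have cV := @continuousV R 'rV[R]_n (fun z => norm2 z `^ (1 - p)) y N0
  (continuous_norm2_powR y0).
exact: (@continuousZ R 'rV[R]_n 'rV[R]_n _ (fun z => z) y cV cvg_id).
Qed.

Lemma continuous_g_pq (p q : R) y : y != 0 -> continuous_at y (g_pq p q).
Proof.
move=> y0; rewrite -[g_pq p q]/(g_p p + (fun z => norm2 z `^ (q - 1) *: z)).
have cZ := @continuousZ R 'rV[R]_n 'rV[R]_n _ (fun z => z) y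
  (continuous_norm2_powR (r := q - 1) (norm2_gt0 y0)) cvg_id.
exact: continuousD (@continuous_g_p p y y0) cZ.
Qed.

Lemma continuous_g_e y : y != 0 -> continuous_at y g_e.
Proof.
move=> /norm2_gt0 y0; rewrite -[g_e]/(fun z => (expR (norm2 z) / norm2 z) *: z).
have N0 : norm2 y != 0 by rewrite gt_eqF.
have cexp := continuous_comp (@norm2_continuous R n y) (@continuous_expR R _).
have cV := @continuousV R 'rV[R]_n (@norm2 R n) y N0 (@norm2_continuous R n y).
exact: (@continuousZ R 'rV[R]_n 'rV[R]_n _ (fun z => z) y (cvgM cexp cV) cvg_id).
Qed.

Lemma dot_g_p (p : R) y : 0 < p + 1 -> dot y (g_p p y) = norm2 y `^ (p + 1).
Proof.
move=> p1; rewrite /g_p dotvZ -norm2_sqr.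
have [->|y0] := eqVneq y 0; first by rewrite norm2_0 expr0n mulr0 powR0 ?gt_eqF.
have N0 := norm2_gt0 y0.
rewrite -powRN -powR_mulrn ?ltW// -powRD; last by rewrite (gt_eqF N0) implybT.
by congr (_ `^ _); ring.
Qed.

Lemma dot_g_pq (p q : R) y : 0 < p + 1 -> 0 < q + 1 ->
  dot y (g_pq p q y) = norm2 y `^ (p + 1) + norm2 y `^ (q + 1).
Proof.
move=> p1 q1; rewrite /g_pq dotvD dot_g_p// dotvZ -norm2_sqr; congr (_ + _).
have [->|y0] := eqVneq y 0; first by rewrite norm2_0 expr0n mulr0 powR0 ?gt_eqF.
have N0 := norm2_gt0 y0.
rewrite -powR_mulrn ?ltW// -powRD; last by rewrite (gt_eqF N0) implybT.
by congr (_ `^ _); ring.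
Qed.

Lemma dot_g_e y : dot y (g_e y) = norm2 y * expR (norm2 y).
Proof.
rewrite /g_e dotvZ -norm2_sqr.
have [->|y0] := eqVneq y 0; first by rewrite norm2_0 expr0n mulr0 mul0r.
by rewrite expr2 mulrA divfK ?gt_eqF ?norm2_gt0// mulrC.
Qed.

End Fields.

(** * The integrals of v / phi(v) *)

Section ValueIntegrals.
Context {R : realType}.
Implicit Types (F : R -> R) (a b alpha beta v w mu : R).

Lemma powR_integral_le F (h : R -> R) a alpha w : 0 < a -> alpha < 2 -> 0 <= w ->
  (forall v, 0 <= v -> v <= w -> is_derive v 1 F (h v)) ->
  (forall v, 0 < v -> v < w -> h v <= a^-1 * v `^ (1 - alpha)) ->
  F w - F 0 <= w `^ (2 - alpha) / (a * (2 - alpha)).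
Proof.
move=> a0 al w0 dF hle.
have r0 : 2 - alpha != 0 by apply/eqP; lra.
have := primitive_increment_le (G := fun v => v `^ (2 - alpha) / (a * (2 - alpha))) w0 dF.
rewrite powR0// mul0r subr0; apply.
  move=> v v0 vw; exists (a^-1 * v `^ (2 - alpha - 1)).
    exact: is_derive_powR_primitive.
  by rewrite (_ : 2 - alpha - 1 = 1 - alpha); [exact: hle | ring].
by apply: within_continuous_powR; lra.
Qed.

(** The quotient v / (a v^alpha + b v^beta), with v^alpha cancelled so that it is
    defined and continuous at v = 0. *)
Definition pq_weight a b alpha beta v : R :=
  `|v| `^ (1 - alpha) / (a + b * `|v| `^ (beta - alpha)).

Lemma pq_denominator_gt0 a b alpha beta v : 0 < a -> 0 < b ->
  0 < a + b * `|v| `^ (beta - alpha).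
Proof. by move=> a0 b0; rewrite ltr_pwDl// mulr_ge0 ?powR_ge0// ltW. Qed.

Lemma pq_weight_continuous a b alpha beta : 0 < a -> 0 < b ->
  alpha < 1 -> 1 < beta -> continuous (pq_weight a b alpha beta).
Proof.
move=> a0 b0 alpha1 beta1 v; have al0 : 0 < 1 - alpha by rewrite subr_gt0.
have ba0 : 0 < beta - alpha by rewrite subr_gt0; exact: lt_trans beta1.
have den0 : a + b * `|v| `^ (beta - alpha) != 0 by rewrite gt_eqF// pq_denominator_gt0.
apply: cvgM; first exact: continuous_norm_powR.
apply: (@continuousV R R (fun v => a + b * `|v| `^ (beta - alpha)) v den0).
apply: cvgD; first exact: cvg_cst.
by apply: cvgM; [exact: cvg_cst | exact: continuous_norm_powR].
Qed.

Lemma pq_weight_ge0 a b alpha beta v : 0 < a -> 0 < b ->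
  0 <= pq_weight a b alpha beta v.
Proof. by move=> a0 b0; rewrite divr_ge0 ?powR_ge0// ltW// pq_denominator_gt0. Qed.

Lemma pq_weight_dissipation a b alpha beta v : 0 < a -> 0 < b -> 0 <= v ->
  v <= pq_weight a b alpha beta v * (a * v `^ alpha + b * v `^ beta).
Proof.
move=> a0 b0; rewrite le_eqVlt => /predU1P[<-|v0].
  by rewrite mulr_ge0 ?pq_weight_ge0// addr_ge0// mulr_ge0 ?powR_ge0// ltW.
have den0 := pq_denominator_gt0 alpha beta v a0 b0.
move: den0; rewrite /pq_weight gtr0_norm// => den0.
rewrite mulrAC ler_pdivlMr//.
have -> : v `^ beta = v `^ alpha * v `^ (beta - alpha).
  by rewrite -powRD ?(gt_eqF v0) ?implybT// subrKC.
rewrite [X in _ <= _ * X](_ : _ =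
  v `^ alpha * (a + b * v `^ (beta - alpha))); last by ring.
by rewrite mulrA -powRD ?(gt_eqF v0) ?implybT// subrK powRr1 ?lexx// ltW.
Qed.

(** Below 1 the term a v^alpha of the denominator is kept, and above 1 the term
    b v^beta: either one alone gives an upper bound at every v > 0, but only the
    first is integrable at 0 for all beta. *)
Lemma pq_weight_le_low a b alpha beta v : 0 < a -> 0 < b -> 0 < v ->
  pq_weight a b alpha beta v <= a^-1 * v `^ (1 - alpha).
Proof.
move=> a0 b0 v0; have := pq_denominator_gt0 alpha beta v a0 b0.
rewrite /pq_weight gtr0_norm// => den0.
rewrite mulrC ler_wpM2r ?powR_ge0// lef_pV2 ?posrE//.
by rewrite lerDl mulr_ge0 ?powR_ge0// ltW.
Qed.

Lemma pq_weight_le_high a b alpha beta v : 0 < a -> 0 < b -> 0 < v ->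
  pq_weight a b alpha beta v <= b^-1 * v `^ (1 - beta).
Proof.
move=> a0 b0 v0; have := pq_denominator_gt0 alpha beta v a0 b0.
rewrite /pq_weight gtr0_norm// => den0.
rewrite ler_pdivrMr//.
have -> : v `^ (1 - alpha) = b^-1 * v `^ (1 - beta) * (b * v `^ (beta - alpha)).
  rewrite mulrACA mulVf ?gt_eqF// mul1r -powRD ?(gt_eqF v0) ?implybT//.
  by congr (_ `^ _); ring.
rewrite ler_wpM2l ?mulr_ge0 ?invr_ge0 ?powR_ge0 ?(ltW b0)//.
by rewrite lerDr ltW.
Qed.

(** The integral is cut at v = 1, with [G] a primitive of v^(1 - beta) / b; the
    maximum covers w <= 1, where only the first part is present. *)
Lemma pq_integral_le F (G : R -> R) a b alpha beta w : 0 < a -> 0 < b ->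
  alpha < 1 -> 1 < beta -> 0 <= w ->
  (forall v, 0 <= v -> is_derive v 1 F (pq_weight a b alpha beta v)) ->
  (forall v, 1 <= v -> is_derive v 1 G (b^-1 * v `^ (1 - beta))) ->
  F w - F 0 <= (a * (2 - alpha))^-1 + (G (Num.max w 1) - G 1).
Proof.
move=> a0 b0 alpha1 beta1 w0 dF dG; set v1 := Num.max w 1.
have v11 : 1 <= v1 by rewrite le_max lexx orbT.
have low v : 0 <= v -> v <= 1 -> F v - F 0 <= (a * (2 - alpha))^-1.
  move=> v0 v1'.
  have alpha2 : alpha < 2 by lra.
  have := powR_integral_le a0 alpha2 v0 (fun z z0 _ => dF z z0)
    (fun z z0 _ => pq_weight_le_low alpha beta a0 b0 z0).
  move=> /le_trans; apply; rewrite -[leRHS]mul1r ler_wpM2r//.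
    by rewrite invr_ge0; apply: mulr_ge0; lra.
  have r0 : 0 <= 2 - alpha by lra.
  by have := ge0_ler_powR r0 (x := v) (y := 1); rewrite !nnegrE powR1; exact.
have [w1|w1] := leP w 1.
  have -> : v1 = 1 by rewrite /v1 max_r.
  by rewrite subrr addr0 low.
have -> : v1 = w by rewrite /v1 max_l// ltW.
have := low 1 ler01 (lexx 1).
suff : F w - F 1 <= G w - G 1 by lra.
apply: (primitive_increment_le (ltW w1) (h := pq_weight a b alpha beta)).
- by move=> v v1' _; apply: dF; lra.
- move=> v v1' _; exists (b^-1 * v `^ (1 - beta)); first exact/dG/ltW.
  by apply: pq_weight_le_high => //; lra.
- apply: derivable_within_continuous => v; rewrite in_itv/= => /andP[v1' _].
  by have [] := dG v v1'.
Qed.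

End ValueIntegrals.

Section ExponentialWeight.
Context {R : realType}.
Implicit Types (mu v w : R).

(** With s = sqrt (2 mu v) this is s e^{-s} / (2 mu), which is v / (s e^s) for v > 0. *)
Definition exp_weight mu v : R :=
  Num.sqrt (2 * mu * v) * expR (- Num.sqrt (2 * mu * v)) / (2 * mu).

(** In the variable s = sqrt (2 mu v), where dv = s ds / mu, the integral of
    [exp_weight] becomes that of s^2 e^{-s} / (2 mu^2), and
    - (s^2 + 2 s + 2) e^{-s} is a primitive of s^2 e^{-s}. *)
Definition exp_primitive mu v : R :=
  let s := Num.sqrt (2 * mu * v) in
  - ((s ^+ 2 + 2 * s + 2) * expR (- s)) / (2 * mu ^+ 2).

Lemma continuous_sqrt_scale mu : continuous (fun v : R => Num.sqrt (2 * mu * v)).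
Proof.
move=> v; have cl : continuous_at v (fun v : R => 2 * mu * v).
  by apply: cvgM; [exact: cvg_cst | exact: cvg_id].
exact: (continuous_comp cl (@sqrt_continuous R _)).
Qed.

Lemma continuous_expR_sqrt_scale mu :
  continuous (fun v : R => expR (- Num.sqrt (2 * mu * v))).
Proof.
move=> v; have cl : continuous_at v (fun v : R => - Num.sqrt (2 * mu * v)).
  by apply: cvgN; exact: continuous_sqrt_scale.
exact: (continuous_comp cl (@continuous_expR R _)).
Qed.

Lemma exp_weight_continuous mu : continuous (exp_weight mu).
Proof.
move=> v; apply: cvgMr_tmp; apply: cvgM; first exact: continuous_sqrt_scale.
exact: continuous_expR_sqrt_scale.
Qed.

Lemma exp_weight_dissipation mu v : 0 < mu -> 0 <= v ->
  v <= exp_weight mu v * (Num.sqrt (2 * mu * v) * expR (Num.sqrt (2 * mu * v))).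
Proof.
move=> mu0 v0; rewrite /exp_weight; set s := Num.sqrt _.
have s2 : s ^+ 2 = 2 * mu * v by rewrite sqr_sqrtr// !mulr_ge0// ltW.
have mu2 : 2 * mu != 0 by rewrite mulf_neq0// gt_eqF.
rewrite [leRHS](_ : _ = s ^+ 2 * (expR (- s) * expR s) / (2 * mu)); last first.
  by field; rewrite gt_eqF.
by rewrite -expRD addNr expR0 mulr1 s2 mulrAC mulfV// mul1r lexx.
Qed.

Lemma is_derive_gamma3_tail (s : R) :
  is_derive s 1 (fun t : R => - ((t ^+ 2 + 2 * t + 2) * expR (- t)))
    (s ^+ 2 * expR (- s)).
Proof.
have dE := is_derive1_comp (is_derive_expR (- s)) (is_deriveN (is_derive_id s (1 : R))).
have d2 : is_derive s 1 (fun t : R => t ^+ 2) (2 * s).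
  rewrite (_ : (fun t : R => t ^+ 2) = (id : R -> R) ^+ 2); last first.
    by apply/funext => t; rewrite fctE.
  apply: (is_derive_eq (is_deriveX 2 (is_derive_id s (1 : R)))).
  by rewrite /GRing.scale/=; ring.
have d1 := is_deriveD (is_deriveD d2 (is_deriveZ 2 (is_derive_id s (1 : R))))
  (is_derive_cst (2 : R) s (1 : R)).
apply: (is_derive_eq (is_deriveN (is_deriveM d1 dE))).
by rewrite !fctE /= /GRing.scale/=; ring.
Qed.

Lemma exp_primitive_derive mu v : 0 < mu -> 0 < v ->
  is_derive v 1 (exp_primitive mu) (exp_weight mu v).
Proof.
move=> mu0 v0.
have mv0 : 0 < 2 * mu * v by rewrite !mulr_gt0.
set s := Num.sqrt (2 * mu * v).
have s0 : 0 < s by rewrite sqrtr_gt0.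
have ds : is_derive v 1 (fun v : R => Num.sqrt (2 * mu * v)) (mu / s).
  have dl : is_derive v 1 (fun v : R => 2 * mu * v) (2 * mu).
    have := is_deriveZ (2 * mu) (is_derive_id v (1 : R)).
    by rewrite /GRing.scale/= mulr1.
  apply: (is_derive_eq (is_derive1_comp (is_derive1_sqrt mv0) dl)).
  rewrite -/s; field; exact/lt0r_neq0.
rewrite (_ : exp_primitive mu =
  (2 * mu ^+ 2)^-1 *: (((fun t : R => - ((t ^+ 2 + 2 * t + 2) * expR (- t))) \o
    (fun v : R => Num.sqrt (2 * mu * v))) : R -> R^o)); last first.
  by apply/funext => t; rewrite /exp_primitive/= mulrC.
have dc := @is_derive1_comp R _ (fun v : R => Num.sqrt (2 * mu * v)) v _ _
  (is_derive_gamma3_tail s) ds.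
have dz := is_deriveZ (2 * mu ^+ 2)^-1 dc.
apply: (is_derive_eq dz).
rewrite /exp_weight -/s /GRing.scale/=; field.
by rewrite !gt_eqF.
Qed.

(** [exp_primitive] is negative and equals - mu^-2 at 0; this is the value
    Gamma(3) / (2 mu^2) of the integral over the whole half-line. *)
Lemma exp_integral_le (F : R -> R) mu w : 0 < mu -> 0 <= w ->
  (forall v, 0 <= v -> is_derive v 1 F (exp_weight mu v)) ->
  F w - F 0 <= mu ^- 2.
Proof.
move=> mu0 w0 dF.
have cE : {within `[0, w], continuous (exp_primitive mu)}.
  apply: continuous_subspaceT => v; apply: cvgMr_tmp; apply: cvgN.
  have cs := @continuous_sqrt_scale mu v.
  apply: cvgM; last exact: continuous_expR_sqrt_scale.
  apply: cvgD; last exact: cvg_cst.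
  apply: cvgD; first exact: cvgM.
  by apply: cvgM => //; exact: cvg_cst.
have := primitive_increment_le w0 (fun z z0 _ => dF z z0) _ cE => /(_ _)/le_trans.
apply=> [v v0 _|]; first by exists (exp_weight mu v) => //; exact: exp_primitive_derive.
rewrite /exp_primitive mulr0 sqrtr0.
rewrite oppr0 expR0 expr0n mulr0 !add0r mulr1.
set s := Num.sqrt _.
rewrite (_ : - 2 / (2 * mu ^+ 2) = - mu ^- 2); last by field; rewrite gt_eqF.
rewrite opprK gerDr mulr_le0_ge0// ?oppr_le0.
  rewrite mulr_ge0 ?expR_ge0//; have := sqrtr_ge0 (2 * mu * w); rewrite -/s.
  by have := sqr_ge0 s; lra.
by rewrite invr_ge0 mulr_ge0// sqr_ge0.
Qed.

End ExponentialWeight.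

(** * The regret bounds *)

Theorem theorem6 (R : realType) (n : nat) (f : 'rV[R]_n -> R)
  (xstar : 'rV[R]_n) (mu p q : R) (x0 : 'rV[R]_n)
  (f_C1 : continuously_differentiable f)
  (f_min : minimizers f xstar)
  (mu_gt0 : 0 < mu)
  (f_PL : forall y, mu * (f y - f xstar) <= 2^-1 * norm2 (gradient f y) ^+ 2)
  (p_ge0 : 0 <= p) (p_lt1 : p < 1) (q_gt1 : 1 < q) :
  let fmin := f xstar in
  let alpha := (p + 1) / 2 in
  let beta := (q + 1) / 2 in
  let a := (2 * mu) `^ alpha in
  let b := (2 * mu) `^ beta in
  let V0 := f x0 - fmin in
  [/\ forall x : R -> 'rV[R]_n,
        solution (flow_field f g_1) x0 x ->
        (regret f fmin x +oo <= (V0 / (2 * mu))%:E)%E,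
      forall x : R -> 'rV[R]_n,
        solution (flow_field f (g_p p)) x0 x ->
        (regret f fmin x (settling_time f x)
           <= (V0 `^ (2 - alpha) / (a * (2 - alpha)))%:E)%E,
      forall x : R -> 'rV[R]_n,
        solution (flow_field f (g_pq p q)) x0 x ->
        [/\ 1 < beta < 2 ->
              (regret f fmin x (settling_time f x)
                 <= ((a * (2 - alpha))^-1
                     + V0 `^ (2 - beta) / (b * (2 - beta)))%:E)%E,
            beta = 2 ->
              (regret f fmin x (settling_time f x)
                 <= ((a * (2 - alpha))^-1 + ln (1 + V0) / b)%:E)%E
          & 2 < beta ->
              (regret f fmin x (settling_time f x)
                 <= ((a * (2 - alpha))^-1 + (b * (beta - 2))^-1)%:E)%E]
    & forall x : R -> 'rV[R]_n,
        solution (flow_field f g_e) x0 x ->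
        (regret f fmin x (settling_time f x) <= (mu ^- 2)%:E)%E].

Proof.
move=> fmin alpha beta a b V0.
have fm y : fmin <= f y by exact: f_min.
have V00 : 0 <= V0 by rewrite subr_ge0.
have PL y : 2 * mu * (f y - fmin) <= norm2 (gradient f y) ^+ 2.
  by have := f_PL y; rewrite -/fmin; lra.
have mu2 : 0 < 2 * mu by lra.
have a0 : 0 < a by exact: powR_gt0.
have b0 : 0 < b by exact: powR_gt0.
have p1 : 0 < p + 1 by lra.
have q1 : 0 < q + 1 by lra.
have alpha1 : alpha < 1 by rewrite /alpha; lra.
have beta1 : 1 < beta by rewrite /beta; lra.
have N0 y : 0 <= norm2 (gradient f y) by exact: norm2_ge0.
have dissip_p y : a * (f y - fmin) `^ alpha <= norm2 (gradient f y) `^ (p + 1).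
  by apply: powR_sqr_le (PL y); rewrite ?subr_ge0// ltW.
have dissip_q y : b * (f y - fmin) `^ beta <= norm2 (gradient f y) `^ (q + 1).
  by apply: powR_sqr_le (PL y); rewrite ?subr_ge0// ltW.
split.
- move=> x; apply: (regret_le _ (phi := fun v => 2 * mu * v)
    (c := fun=> (2 * mu)^-1) f_C1 fm).
  + by move=> y _; exact: cvg_id.
  + by move=> y; rewrite -norm2_sqr.
  + by move=> v; exact: cvg_cst.
  + by move=> v _; rewrite invr_ge0 ltW.
  + by move=> v v0; rewrite mulKf ?lexx// gt_eqF.
  + move=> Phi dPhi; have l12 : (1 : R) < 2 by lra.
    have := @powR_integral_le _ _ _ _ _ _ mu2 l12 V00 (fun z z0 _ => dPhi z z0).
    rewrite (_ : 2 - 1 = 1 :> R); last by ring.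
    rewrite powRr1// mulr1; apply => z _ _.
    by rewrite subrr powRr0 mulr1.
- move=> x; apply: (regret_le _ (phi := fun v => a * v `^ alpha)
    (c := fun v => a^-1 * `|v| `^ (1 - alpha)) f_C1 fm).
  + by move=> y; exact: continuous_g_p.
  + by move=> y; rewrite dot_g_p.
  + move=> v; apply: cvgM; first exact: cvg_cst.
    by apply: continuous_norm_powR; rewrite subr_gt0.
  + by move=> v _; rewrite mulr_ge0 ?powR_ge0// invr_ge0 ltW.
  + move=> v; rewrite le_eqVlt => /predU1P[<-|v0].
      by rewrite !mulr_ge0 ?powR_ge0 ?invr_ge0// ltW.
    rewrite gtr0_norm// mulrACA mulVf ?gt_eqF// mul1r -powRD ?(gt_eqF v0) ?implybT//.
    by rewrite subrK powRr1 ?lexx// ltW.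
  + move=> Phi dPhi; have alpha2 : alpha < 2 by lra.
    apply: (powR_integral_le a0 alpha2 V00 (fun z z0 _ => dPhi z z0)) => z z0 _.
    by rewrite gtr0_norm.
- move=> x sol.
  have bound (B : R) : (forall Phi : R -> R,
      (forall v : R, 0 <= v -> is_derive v 1 Phi (pq_weight a b alpha beta v)) ->
      Phi V0 - Phi 0 <= B) ->
      (regret f fmin x (settling_time f x) <= B%:E)%E.
    move=> PhiB; apply: (regret_le _ (phi := fun v => a * v `^ alpha + b * v `^ beta)
      f_C1 fm _ _ _ _ _ PhiB sol).
    + by move=> y; exact: continuous_g_pq.
    + by move=> y; rewrite dot_g_pq// lerD.
    + exact: pq_weight_continuous.
    + by move=> v _; exact: pq_weight_ge0.
    + by move=> v v0; exact: pq_weight_dissipation.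
  have dpow (v : R) : beta != 2 -> 1 <= v ->
      is_derive v 1 (fun z : R => z `^ (2 - beta) / (b * (2 - beta)))
        (b^-1 * v `^ (1 - beta)).
    move=> beta2 v1; rewrite (_ : 1 - beta = 2 - beta - 1); last by ring.
    by apply: is_derive_powR_primitive; [lra | rewrite subr_eq0 eq_sym].
  have max1 : 1 <= Num.max V0 1 by rewrite le_max lexx orbT.
  split.
  + move=> /andP[_ beta2]; apply: bound => Phi dPhi.
    have beta2' : beta != 2 by rewrite lt_eqF.
    have := pq_integral_le a0 b0 alpha1 beta1 V00 dPhi (fun z => dpow z beta2').
    move=> /le_trans; apply; rewrite lerD2l.
    have k0 : 0 < (b * (2 - beta))^-1 by rewrite invr_gt0; apply: mulr_gt0; lra.
    rewrite powR1 mul1r; have [V1|V1] := leP V0 1.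
      by rewrite powR1 mul1r subrr; apply: mulr_ge0; [exact: powR_ge0 | exact: ltW].
    by lra.
  + move=> beta2; apply: bound => Phi dPhi.
    have dln (v : R) : 1 <= v -> is_derive v 1 (fun z : R => b^-1 * ln z)
        (b^-1 * v `^ (1 - beta)).
      move=> v1; have v0 : 0 < v by lra.
      apply: (is_derive_eq (is_deriveZ b^-1 (is_derive1_ln v0))).
      rewrite (_ : 1 - beta = - 1); last by rewrite beta2; ring.
      by rewrite powR_inv1// ltW.
    have := pq_integral_le a0 b0 alpha1 beta1 V00 dPhi dln.
    move=> /le_trans; apply; rewrite lerD2l ln1 mulr0 subr0 mulrC ler_pM2r ?invr_gt0//.
    by rewrite ler_ln ?posrE ?ge_max; lra.
  + move=> beta2; apply: bound => Phi dPhi.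
    have beta2' : beta != 2 by rewrite gt_eqF.
    have := pq_integral_le a0 b0 alpha1 beta1 V00 dPhi (fun z => dpow z beta2').
    move=> /le_trans; apply; rewrite lerD2l.
    have k0 : 0 < (b * (beta - 2))^-1 by rewrite invr_gt0; apply: mulr_gt0; lra.
    rewrite (_ : 2 - beta = - (beta - 2)); last by ring.
    rewrite mulrN invrN powR1 mul1r !mulrN opprK gerDr oppr_le0.
    by apply: mulr_ge0; [exact: powR_ge0 | exact: ltW].
- move=> x; apply: (regret_le _
    (phi := fun v => Num.sqrt (2 * mu * v) * expR (Num.sqrt (2 * mu * v)))
    (c := exp_weight mu) f_C1 fm).
  + by move=> y; exact: continuous_g_e.
  + move=> y; rewrite dot_g_e.
    have sN : Num.sqrt (2 * mu * (f y - fmin)) <= norm2 (gradient f y).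
      by rewrite -[leRHS]ger0_norm// -sqrtr_sqr ler_wsqrtr.
    by apply: ler_pM; rewrite ?sqrtr_ge0 ?expR_ge0 ?ler_expR.
  + exact: exp_weight_continuous.
  + by move=> v v0; rewrite divr_ge0 ?mulr_ge0 ?sqrtr_ge0 ?expR_ge0// ltW.
  + by move=> v; exact: exp_weight_dissipation.
  + by move=> Phi dPhi; exact: exp_integral_le.
Qed.
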